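(* Let $a,b\in\mathbb{R}^+$ with $a<b$ and let $n\in\mathbb{Z}$ with $|n|\ge 2$. Then $$\left|L_n^n(a,b)-A^n(a,b)\right|\le\frac{n(n-1)(b-a)^2}{192}\left[a^{n-2}+6A^{n-2}(a,b)+b^{n-2}\right].$$
   Context: $\mathbb{R}^+$ is the set of positive reals. For $\alpha,\beta\in\mathbb{R}^+$, the arithmetic mean is $A(\alpha,\beta)=\frac{\alpha+\beta}{2}$. For $\alpha\neq\beta$ and $n\in\mathbb{Z}\setminus\{-1,0\}$ the generalized logarithmic mean is $L_n(\alpha,\beta)=\left[\frac{\beta^{n+1}-\alpha^{n+1}}{(\beta-\alpha)(n+1)}\right]^{1/n}$. $L_n^n(a,b)$ denotes $(L_n(a,b))^n$ and $A^k(a,b)$ denotes $(A(a,b))^k$. *)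

(* Defs.v *)
From Stdlib Require Import Reals ZArith.

Open Scope R_scope.

Definition A (alpha beta : R) : R := (alpha + beta) / 2.

(* Meaningful for positive alpha <> beta and n not in {-1, 0}: the base is then
   positive, so Rpower (which is exp (y * ln x)) is the genuine real power. *)
Definition L (n : Z) (alpha beta : R) : R :=
  Rpower ((powerRZ beta (n + 1) - powerRZ alpha (n + 1))
          / ((beta - alpha) * IZR (n + 1)))
         (1 / IZR n).

(* Main.v *)
Require Import Defs.
From Stdlib Require Import Reals ZArith Lra Lia.
From Coquelicot Require Import Coquelicot.

Open Scope R_scope.

(** For [f x = x ^ n] the number [L n a b ^ n] is the mean value of [f] on
    [[a, b]], so the claim bounds the error of the midpoint rule.  Write [m]
    for the midpoint, [h] for half the length and [F] for a primitive of [f].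
    The error multiplied by [2 h] is [Phi h], where
    [Phi t = F (m + t) - F (m - t) - 2 t f m].  The function [Phi] and its
    first two derivatives vanish at [0], and its third derivative is
    [f'' (m + t) + f'' (m - t)].

    If [f''] is nonnegative, three integrations give [0 <= Phi h].  If [f''] is
    moreover convex, its graph lies below the chords over [[a, m]] and
    [[m, b]], so that the third derivative is at most
    [2 f'' m + (t / h) (f'' a + f'' b - 2 f'' m)]; three integrations
    of this linear function produce exactly the weights [1, 6, 1] and the
    constant [1 / 192] (lemma [midpoint_error_convex]).

    For a power function, [f'' = n (n - 1) x ^ (n - 2)] and the fourth
    derivative [n (n - 1) (n - 2) (n - 3) x ^ (n - 4)] are both nonnegative on
    the positive half-line, because a product of two consecutive integers is
    never negative.  The lower bound also shows that the mean value is
    positive, hence that the [n]-th power cancels the [1 / n]-th power in the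
    definition of [L]. *)

Lemma nonneg_of_derive_nonneg (phi phi' : R -> R) (h : R) :
  (forall t, 0 <= t <= h -> is_derive phi t (phi' t)) ->
  phi 0 = 0 ->
  (forall t, 0 <= t <= h -> 0 <= phi' t) ->
  forall t, 0 <= t <= h -> 0 <= phi t.
Proof.
  intros D phi0 P t [t0 th].
  destruct (Rle_lt_or_eq_dec _ _ t0) as [tpos | <-]; [| lra].
  destruct (MVT_cor2 phi phi' 0 t tpos) as [c [E C]].
  { intros c C; apply is_derive_Reals, D; lra. }
  assert (0 <= phi' c) by (apply P; lra).
  nra.
Qed.

Lemma nonneg_of_derive3_nonneg (phi phi1 phi2 phi3 : R -> R) (h : R) :
  (forall t, 0 <= t <= h -> is_derive phi t (phi1 t)) ->
  (forall t, 0 <= t <= h -> is_derive phi1 t (phi2 t)) ->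
  (forall t, 0 <= t <= h -> is_derive phi2 t (phi3 t)) ->
  phi 0 = 0 -> phi1 0 = 0 -> phi2 0 = 0 ->
  (forall t, 0 <= t <= h -> 0 <= phi3 t) ->
  forall t, 0 <= t <= h -> 0 <= phi t.
Proof.
  intros D D1 D2 E E1 E2 P.
  apply (nonneg_of_derive_nonneg phi phi1 h D E).
  apply (nonneg_of_derive_nonneg phi1 phi2 h D1 E1).
  exact (nonneg_of_derive_nonneg phi2 phi3 h D2 E2 P).
Qed.

(** The slopes of the chords over [[u, x]] and [[x, v]] are values of the
    nondecreasing function [g'] at points on the left and on the right of [x],
    so the first slope is at most the second. *)
Lemma below_chord_of_derive2_nonneg (g g1 g2 : R -> R) (u v x : R) :
  (forall y, u <= y <= v -> is_derive g y (g1 y)) ->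
  (forall y, u <= y <= v -> is_derive g1 y (g2 y)) ->
  (forall y, u <= y <= v -> 0 <= g2 y) ->
  u <= x <= v ->
  (v - u) * g x <= (v - x) * g u + (x - u) * g v.
Proof.
  intros D D1 P [ux xv].
  destruct (Rle_lt_or_eq_dec _ _ ux) as [ux' | <-]; [| lra].
  destruct (Rle_lt_or_eq_dec _ _ xv) as [xv' | ->]; [| lra].
  destruct (MVT_cor2 g g1 u x ux') as [c [E C]].
  { intros y Y; apply is_derive_Reals, D; lra. }
  destruct (MVT_cor2 g g1 x v xv') as [d [E' C']].
  { intros y Y; apply is_derive_Reals, D; lra. }
  assert (cd : c < d) by lra.
  destruct (MVT_cor2 g1 g2 c d cd) as [e [E'' C'']].
  { intros y Y; apply is_derive_Reals, D1; lra. }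
  assert (0 <= g2 e) by (apply P; lra).
  assert (S : g1 c <= g1 d) by nra.
  assert (0 <= (x - u) * (v - x) * (g1 d - g1 c)).
  { repeat apply Rmult_le_pos; lra. }
  nra.
Qed.

Lemma is_derive_reflection (F : R -> R) (m e t l r : R) :
  is_derive F (m + t) r -> is_derive F (m - t) l ->
  is_derive (fun t => F (m + t) + e * F (m - t)) t (r - e * l).
Proof.
  intros Hr Hl.
  assert (Er := is_derive_unique _ _ _ Hr).
  assert (El := is_derive_unique _ _ _ Hl).
  auto_derive.
  - split; [eexists; exact Hr | split; [eexists; exact Hl | exact I]].
  - change (Derive (fun x => F x)) with (Derive F).
    change (m + - t) with (m - t).
    rewrite Er, El; ring.
Qed.

(** Error of the midpoint rule for an integrand whose second derivative [f2]
    is nonnegative and convex. The integral of [f] appears as an increment of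
    its primitive [F]. *)
Lemma midpoint_error_convex (F f f1 f2 f3 f4 : R -> R) (a b : R) :
  a < b ->
  (forall x, a <= x <= b -> is_derive F x (f x)) ->
  (forall x, a <= x <= b -> is_derive f x (f1 x)) ->
  (forall x, a <= x <= b -> is_derive f1 x (f2 x)) ->
  (forall x, a <= x <= b -> is_derive f2 x (f3 x)) ->
  (forall x, a <= x <= b -> is_derive f3 x (f4 x)) ->
  (forall x, a <= x <= b -> 0 <= f2 x) ->
  (forall x, a <= x <= b -> 0 <= f4 x) ->
  0 <= (F b - F a) / (b - a) - f (A a b)
    <= (b - a) ^ 2 / 192 * (f2 a + 6 * f2 (A a b) + f2 b).
Proof.
  intros hab D0 D1 D2 D3 D4 P2 P4.
  set (m := A a b).
  set (h := (b - a) / 2).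
  assert (hpos : 0 < h) by (unfold h; lra).
  assert (Ea : a = m - h) by (unfold m, h, A; lra).
  assert (Eb : b = m + h) by (unfold m, h, A; lra).
  set (Phi := fun t => F (m + t) + (-1) * F (m - t) - 2 * f m * t).
  set (Phi1 := fun t => f (m + t) + 1 * f (m - t) - 2 * f m).
  set (Phi2 := fun t => f1 (m + t) + (-1) * f1 (m - t)).
  set (Phi3 := fun t => f2 (m + t) + f2 (m - t)).
  assert (dPhi : forall t, 0 <= t <= h -> is_derive Phi t (Phi1 t)).
  { intros t T.
    replace (Phi1 t) with ((f (m + t) - -1 * f (m - t)) - 2 * f m)
      by (unfold Phi1; ring).
    apply (is_derive_minus (fun t => F (m + t) + (-1) * F (m - t))
             (fun t => 2 * f m * t)).
    - apply is_derive_reflection; apply D0; lra.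
    - auto_derive; [exact I | ring]. }
  assert (dPhi1 : forall t, 0 <= t <= h -> is_derive Phi1 t (Phi2 t)).
  { intros t T.
    replace (Phi2 t) with ((f1 (m + t) - 1 * f1 (m - t)) - 0)
      by (unfold Phi2; ring).
    apply (is_derive_minus (fun t => f (m + t) + 1 * f (m - t))
             (fun _ => 2 * f m)).
    - apply is_derive_reflection; apply D1; lra.
    - auto_derive; [exact I | ring]. }
  assert (dPhi2 : forall t, 0 <= t <= h -> is_derive Phi2 t (Phi3 t)).
  { intros t T.
    replace (Phi3 t) with (f2 (m + t) - -1 * f2 (m - t))
      by (unfold Phi3; ring).
    apply is_derive_reflection; apply D2; lra. }
  assert (Phi0 : Phi 0 = 0).
  { unfold Phi; rewrite Rplus_0_r, Rminus_0_r; ring. }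
  assert (Phi10 : Phi1 0 = 0).
  { unfold Phi1; rewrite Rplus_0_r, Rminus_0_r; ring. }
  assert (Phi20 : Phi2 0 = 0).
  { unfold Phi2; rewrite Rplus_0_r, Rminus_0_r; ring. }
  assert (lower : 0 <= Phi h).
  { apply (nonneg_of_derive3_nonneg Phi Phi1 Phi2 Phi3 h); trivial; [| lra].
    intros t T; unfold Phi3.
    assert (0 <= f2 (m + t)) by (apply P2; lra).
    assert (0 <= f2 (m - t)) by (apply P2; lra).
    lra. }
  (* The chord bound on [Phi3] is [2 * f2 m + k * t]. *)
  set (k := (f2 a + f2 b - 2 * f2 m) / h).
  assert (Ek : k * h = f2 a + f2 b - 2 * f2 m) by (unfold k; field; lra).
  assert (upper : 0 <= f2 m / 3 * h ^ 3 + k / 24 * h ^ 4 - Phi h).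
  { apply (nonneg_of_derive3_nonneg
             (fun t => f2 m / 3 * t ^ 3 + k / 24 * t ^ 4 - Phi t)
             (fun t => f2 m * t ^ 2 + k / 6 * t ^ 3 - Phi1 t)
             (fun t => 2 * f2 m * t + k / 2 * t ^ 2 - Phi2 t)
             (fun t => 2 * f2 m + k * t - Phi3 t) h); try lra.
    - intros t T.
      apply (is_derive_minus (fun t => f2 m / 3 * t ^ 3 + k / 24 * t ^ 4) Phi);
        [auto_derive; [exact I | simpl; field] | apply dPhi, T].
    - intros t T.
      apply (is_derive_minus (fun t => f2 m * t ^ 2 + k / 6 * t ^ 3) Phi1);
        [auto_derive; [exact I | simpl; field] | apply dPhi1, T].
    - intros t T.
      apply (is_derive_minus (fun t => 2 * f2 m * t + k / 2 * t ^ 2) Phi2);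
        [auto_derive; [exact I | simpl; field] | apply dPhi2, T].
    - intros t T; unfold Phi3.
      assert (Cr := below_chord_of_derive2_nonneg f2 f3 f4 m b (m + t)).
      assert (Cl := below_chord_of_derive2_nonneg f2 f3 f4 a m (m - t)).
      assert (Br : (b - m) * f2 (m + t)
                   <= (b - (m + t)) * f2 m + (m + t - m) * f2 b).
      { apply Cr; intros; try apply D3; try apply D4; try apply P4; lra. }
      assert (Bl : (m - a) * f2 (m - t)
                   <= (m - (m - t)) * f2 a + (m - t - a) * f2 m).
      { apply Cl; intros; try apply D3; try apply D4; try apply P4; lra. }
      replace (b - m) with h in Br by lra.
      replace (m - a) with h in Bl by lra.
      replace (b - (m + t)) with (h - t) in Br by lra.
      replace (m - t - a) with (h - t) in Bl by lra.
      apply (Rmult_le_reg_l h); [exact hpos |].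
      replace (h * (2 * f2 m + k * t - (f2 (m + t) + f2 (m - t))))
        with (2 * h * f2 m + k * h * t - h * f2 (m + t) - h * f2 (m - t))
        by ring.
      rewrite Ek; nra. }
  assert (Emean : (F b - F a) / (b - a) - f m = Phi h / (2 * h)).
  { replace (b - a) with (2 * h) by (unfold h; lra).
    unfold Phi; rewrite <- Ea, <- Eb; field; lra. }
  rewrite Emean; split.
  - apply Rdiv_le_0_compat; lra.
  - apply (Rmult_le_reg_r (2 * h)); [lra |].
    replace (Phi h / (2 * h) * (2 * h)) with (Phi h) by (field; lra).
    replace (k / 24 * h ^ 4) with (k * h * h ^ 3 / 24) in upper by field.
    rewrite Ek in upper.
    replace (b - a) with (2 * h) by (unfold h; lra).
    simpl in upper |- *; lra.
Qed.

Lemma is_derive_powerRZ_pos (n : Z) (x : R) :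
  0 < x ->
  is_derive (fun y => powerRZ y n) x (IZR n * powerRZ x (n - 1)).
Proof.
  intros xpos.
  apply (is_derive_ext_loc (fun y => Rpower y (IZR n))).
  - exists (mkposreal x xpos); intros y Y.
    symmetry; apply powerRZ_Rpower.
    apply Rabs_def2 in Y; unfold minus, plus, opp in Y; simpl in Y; lra.
  - rewrite powerRZ_Rpower, minus_IZR by exact xpos.
    apply is_derive_Reals, derivable_pt_lim_power, xpos.
Qed.

Lemma is_derive_scal_powerRZ_pos (c : R) (n : Z) (x : R) :
  0 < x ->
  is_derive (fun y => c * powerRZ y n) x (c * IZR n * powerRZ x (n - 1)).
Proof.
  intros xpos.
  rewrite Rmult_assoc.
  apply is_derive_scal, is_derive_powerRZ_pos, xpos.
Qed.

(** False for real [n]: no integer lies strictly between [0] and [1]. *)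
Lemma consecutive_mult_nonneg (n : Z) : 0 <= IZR n * (IZR n - 1).
Proof.
  rewrite <- minus_IZR, <- mult_IZR.
  apply IZR_le; nia.
Qed.

Lemma powerRZ_L (n : Z) (a b : R) :
  n <> 0%Z ->
  0 < (powerRZ b (n + 1) - powerRZ a (n + 1)) / ((b - a) * IZR (n + 1)) ->
  powerRZ (L n a b) n
  = (powerRZ b (n + 1) - powerRZ a (n + 1)) / ((b - a) * IZR (n + 1)).
Proof.
  intros n0 pos.
  rewrite powerRZ_Rpower by apply exp_pos.
  unfold L; rewrite Rpower_mult.
  replace (1 / IZR n * IZR n) with 1
    by (field; apply (eq_IZR_contrapositive n 0%Z n0)).
  apply Rpower_1, pos.
Qed.

Theorem proposition2 (a b : R) (n : Z)
  (ha : 0 < a) (hb : 0 < b) (hab : a < b) (hn : (2 <= Z.abs n)%Z) :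
  Rabs (powerRZ (L n a b) n - powerRZ (A a b) n)
  <= IZR n * (IZR n - 1) * (b - a) ^ 2 / 192
     * (powerRZ a (n - 2) + 6 * powerRZ (A a b) (n - 2) + powerRZ b (n - 2)).
Proof.
  assert (n0 : n <> 0%Z) by lia.
  assert (n1 : IZR (n + 1) <> 0) by (apply (eq_IZR_contrapositive (n + 1) 0); lia).
  destruct (midpoint_error_convex
    (fun x => / IZR (n + 1) * powerRZ x (n + 1))
    (fun x => powerRZ x n)
    (fun x => IZR n * powerRZ x (n - 1))
    (fun x => IZR n * IZR (n - 1) * powerRZ x (n - 1 - 1))
    (fun x => IZR n * IZR (n - 1) * IZR (n - 1 - 1) * powerRZ x (n - 1 - 1 - 1))
    (fun x => IZR n * IZR (n - 1) * IZR (n - 1 - 1) * IZR (n - 1 - 1 - 1)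
              * powerRZ x (n - 1 - 1 - 1 - 1)) a b hab)
    as [lower upper]; try (intros x X; assert (xpos : 0 < x) by lra).
  - replace (powerRZ x n)
      with (/ IZR (n + 1) * IZR (n + 1) * powerRZ x (n + 1 - 1))
      by (replace (n + 1 - 1)%Z with n by lia; field; exact n1).
    apply is_derive_scal_powerRZ_pos, xpos.
  - apply is_derive_powerRZ_pos, xpos.
  - apply is_derive_scal_powerRZ_pos, xpos.
  - apply is_derive_scal_powerRZ_pos, xpos.
  - apply is_derive_scal_powerRZ_pos, xpos.
  - apply Rmult_le_pos; [| apply powerRZ_le, xpos].
    rewrite minus_IZR; apply consecutive_mult_nonneg.
  - apply Rmult_le_pos; [| apply powerRZ_le, xpos].
    rewrite (Rmult_assoc (IZR n * _)).
    apply Rmult_le_pos;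
      [rewrite (minus_IZR n 1) | rewrite (minus_IZR (n - 1 - 1) 1)];
      apply consecutive_mult_nonneg.
  - cbv beta in lower, upper.
    set (M := (powerRZ b (n + 1) - powerRZ a (n + 1)) / ((b - a) * IZR (n + 1))).
    assert (EM : (/ IZR (n + 1) * powerRZ b (n + 1)
                  - / IZR (n + 1) * powerRZ a (n + 1)) / (b - a) = M)
      by (unfold M; field; split; [exact n1 | lra]).
    rewrite EM in lower, upper.
    assert (Apos : 0 < powerRZ (A a b) n) by (apply powerRZ_lt; unfold A; lra).
    rewrite powerRZ_L; [fold M | exact n0 | fold M; lra].
    rewrite Rabs_pos_eq by exact lower.
    replace (n - 1 - 1)%Z with (n - 2)%Z in upper by lia.
    rewrite (minus_IZR n 1) in upper.
    lra.
Qed.
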